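(* Let $n$ be a positive integer. For any $K\in\mathcal{K}^n$, $f\in\breve C(K)$ and $P\in\mathcal{P}_{2,n}$ there exists $Q\in\mathcal{P}_{2,n}\cap\breve C(K)$ such that \[ \|f-Q\|_K\le a(K)\,\|f-P\|_K,\qquad\text{where}\quad a(K):=2(d(K))^2 \] and $d(K)$ is the Banach–Mazur distance between $K$ and the unit ball $B_2^n$ of $\mathbb{R}^n$. In particular, for any $K\in\mathcal{K}^n$ and $f\in\breve C(K)$, we have \[ \breve E_2(f;K)\le a(K)\,E_2(f;K)\qquad\text{and}\qquad \breve{\breve w}_3(K)\le a(K)\,\breve w_3(K). \]
   Context: $\mathcal{K}^n$ denotes the class of $n$-dimensional convex bodies, i.e. compact convex subsets of $\mathbb{R}^n$ with nonempty interior. $B_2^n$ is the closed Euclidean unit ball of $\mathbb{R}^n$. For $K\in\mathcal{K}^n$, the Banach–Mazur distance between $K$ and $B_2^n$ is defined as \[ d(K)=\inf\{\lambda:\ B_2^n\subset AK+b\subset\lambda B_2^n\ \text{for some real } n\times n \text{ matrix } A \text{ with } \det A\ne 0 \text{ and some } b\in\mathbb{R}^n\}. \] $C(K)$ is the space of continuous real-valued functions on $K$ with norm $\|f\|_K=\max_{x\in K}|f(x)|$, and $\breve C(K)$ is the set of those $f\in C(K)$ that are convex on $K$, i.e. satisfy $f(x)+f(y)\ge 2f((x+y)/2)$ for all $x,y\in K$. $\mathcal{P}_{m,n}$ is the space of real algebraic polynomials of total degree $\le m$ in $n$ variables; $\mathcal{P}_{m,n}\cap\breve C(K)$ consists of those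 whose restriction to $K$ is convex. For $f\in C(K)$, resp. $f\in\breve C(K)$, \[ E_m(f;K)=\inf_{P\in\mathcal{P}_{m,n}}\|f-P\|_K,\qquad \breve E_m(f;K)=\inf_{P\in\mathcal{P}_{m,n}\cap\breve C(K)}\|f-P\|_K . \] The $m$-th modulus of smoothness is \[ \omega_m(f;K)=\max_{x,x+h,\dots,x+mh\in K}|\Delta_h^m(f;x)|,\qquad \Delta_h^m(f;x)=\sum_{j=0}^m(-1)^j\binom mj f(x+jh), \] the maximum being over all $x,h\in\mathbb{R}^n$ with $x,x+h,\dots,x+mh\in K$. The Whitney constant for convex functions and the convexity preserving Whitney constant are, respectively, \[ \breve w_m(K)=\sup\{E_{m-1}(f;K): f\in\breve C(K),\ \omega_m(f;K)\le 1\}, \] \[ \breve{\breve w}_m(K)=\sup\{\breve E_{m-1}(f;K): f\in\breve C(K),\ \omega_m(f;K)\le 1\}. \] *)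

(* Defs.v *)
From mathcomp Require Import all_boot all_order all_algebra.
From mathcomp Require Import all_classical all_reals all_analysis.
(* The notations of mpoly clash with those of mathcomp-analysis. *)
From mathcomp Require Import -(notations) mpoly.

Set Implicit Arguments.
Unset Strict Implicit.
Unset Printing Implicit Defensive.

Import Order.TTheory GRing.Theory Num.Theory.
Import numFieldNormedType.Exports.

Local Open Scope classical_set_scope.
Local Open Scope ring_scope.

(* Points of R^n are row vectors.  The canonical norm of MathComp-Analysis on
   'rV[R]_n is the sup norm, which induces the usual topology; the Euclidean
   norm is therefore defined separately. *)

Section ConvexBodies.
Variables (R : realType) (n : nat).
Implicit Types (K : set 'rV[R]_n) (x b : 'rV[R]_n).

Definition convex_body K : Prop :=
  [/\ compact K, convex_set K & K° !=set0].

Definition enorm x : R := Num.sqrt (\sum_(i < n) x 0 i ^+ 2).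

Definition euclidean_ball : set 'rV[R]_n := [set x | enorm x <= 1].

(* In terms of rows, the column vector A x is x *m A^T. *)
Definition affine_image (A : 'M[R]_n) b K : set 'rV[R]_n :=
  [set x *m A^T + b | x in K].

(* Positivity of lambda is explicit since (- lambda) B = lambda B as sets. *)
Definition bm_dist K : R :=
  inf [set lambda : R | 0 < lambda /\
    exists (A : 'M[R]_n) b,
      [/\ \det A != 0,
          euclidean_ball `<=` affine_image A b K
        & affine_image A b K `<=` [set lambda *: x | x in euclidean_ball]]].

End ConvexBodies.

Section Approximation.
Variables (R : realType) (n : nat).
Implicit Types (K : set 'rV[R]_n) (f : 'rV[R]_n -> R) (m : nat).
Implicit Types (P Q : mpoly n R).

(* A function on K is represented by any extension of it to R^n; all the
   notions below only depend on the values on K. *)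
Definition cont_on K f : Prop := {within K, continuous f}.

Definition cont_convex_on K f : Prop :=
  cont_on K f /\
  forall x y, K x -> K y -> f x + f y >= 2 * f (2^-1 *: (x + y)).

(* For K compact and nonempty and f continuous on K this sup is a max. *)
Definition norm_on K f : R := sup [set `|f x| | x in K].

Definition poly_fun P : 'rV[R]_n -> R :=
  fun x => meval (fun i => x 0 i) P.

(* mmeasure mdeg (written msize in mpoly) is the total degree plus one, and 0 for the zero polynomial. *)
Definition polys m : set (mpoly n R) :=
  [set P | (mmeasure mdeg P <= m.+1)%N].

Definition convex_polys m K : set (mpoly n R) :=
  [set P | polys m P /\ cont_convex_on K (poly_fun P)].

Definition best_approx m f K : R :=
  inf [set norm_on K (f \- poly_fun P) | P in polys m].

Definition convex_best_approx m f K : R :=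
  inf [set norm_on K (f \- poly_fun P) | P in convex_polys m K].

Definition fin_diff m (h : 'rV[R]_n) f (x : 'rV[R]_n) : R :=
  \sum_(j < m.+1) (-1) ^+ j * 'C(m, j)%:R * f (x + j%:R *: h).

Definition modulus m f K : R :=
  sup [set r | exists x h : 'rV[R]_n,
    (forall j, (j <= m)%N -> K (x + j%:R *: h)) /\ r = `|fin_diff m h f x|].

(* The Whitney constants are meant for 0 < m.  They are suprema in the extended
   reals, so that their finiteness is not built into the definition. *)
Definition whitney_convex m K : \bar R :=
  ereal_sup [set (best_approx m.-1 f K)%:E
            | f in [set f | cont_convex_on K f /\ modulus m f K <= 1]].

Definition whitney_convexity_preserving m K : \bar R :=
  ereal_sup [set (convex_best_approx m.-1 f K)%:E
            | f in [set f | cont_convex_on K f /\ modulus m f K <= 1]].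

Definition approx_const K : R := 2 * bm_dist K ^+ 2.

End Approximation.

(* Main.v *)
Require Import Defs.
From mathcomp Require Import all_boot all_order all_algebra.
From mathcomp Require Import all_classical all_reals all_analysis.
From mathcomp Require Import -(notations) mpoly.
From mathcomp Require Import ring lra.

Import Order.TTheory GRing.Theory Num.Theory.
Import numFieldNormedType.Exports.

Local Open Scope classical_set_scope.
Local Open Scope ring_scope.

(** Write e for the norm of f - P on K, and q for the quadratic part of P, so
    that P(x + h) + P(x - h) = 2 P(x) + 2 q(h) for all x and h.  Suppose that
    an affine map x |-> (x - c) A squeezes K between the unit ball and the
    ball of radius lambda.  If |h A| <= 1, then c + h and c - h lie in K, and
    midpoint convexity of f at c, read off for P, which is within e of f, gives
    q(h) >= -2 e.  By homogeneity q(h) + 2 e |h A|^2 >= 0 for every h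
    ([curvature_lower_bound]).  Hence

      Q(x) = P(x) + 2 e |(x - c) A|^2 - e lambda^2

    is a convex quadratic polynomial.  The correction lies between
    -e lambda^2 and e lambda^2 on K, because |(x - c) A| <= lambda there, so
    |f - Q| <= e (1 + lambda^2) <= 2 lambda^2 e, as lambda >= 1.

    This yields every lambda larger than d = d(K); the value d itself needs a
    limit.  The construction of Q rests on the three properties c in K,
    q(h) + 2 e |h A|^2 >= 0 for all h, and |(x - c) A| <= lambda on K.  Pairs
    (A, c) with these properties are called convexifiers below.  They form a
    closed set, bounded because K has interior points, and this set decreases
    with lambda; hence a cluster point of convexifiers for lambda decreasing
    to d is a convexifier for d ([convexifiers_limit]).

    The inequalities between best approximations and between Whitney constants
    follow by taking the infimum over P and then the supremum over f. *)

Set Implicit Arguments.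
Unset Strict Implicit.

(** * The squared Euclidean norm *)

Definition sqnorm {R : realType} {n : nat} (v : 'rV[R]_n) : R :=
  \sum_(i < n) v 0 i ^+ 2.

Lemma sqnorm_ge0 (R : realType) (n : nat) (v : 'rV[R]_n) : 0 <= sqnorm v.
Proof. by apply: sumr_ge0 => i _; rewrite sqr_ge0. Qed.

Lemma sqnormZ (R : realType) (n : nat) (t : R) (v : 'rV[R]_n) :
  sqnorm (t *: v) = t ^+ 2 * sqnorm v.
Proof.
by rewrite /sqnorm big_distrr; apply: eq_bigr => i _; rewrite mxE exprMn.
Qed.

Lemma sqnorm_eq0 (R : realType) (n : nat) (v : 'rV[R]_n) :
  sqnorm v = 0 -> v = 0.
Proof.
move=> /eqP; rewrite psumr_eq0 => [/allP v0|i _]; last exact: sqr_ge0.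
apply/rowP => i; rewrite mxE; apply/eqP; rewrite -sqrf_eq0.
by apply: v0; rewrite mem_index_enum.
Qed.

Lemma coord_sqr_le_sqnorm (R : realType) (n : nat) (v : 'rV[R]_n) (j : 'I_n) :
  v 0 j ^+ 2 <= sqnorm v.
Proof.
by rewrite /sqnorm (bigD1 j)//= lerDl sumr_ge0// => i _; rewrite sqr_ge0.
Qed.

Lemma enorm_le (R : realType) (n : nat) (v : 'rV[R]_n) (r : R) :
  0 <= r -> (enorm v <= r) = (sqnorm v <= r ^+ 2).
Proof.
move=> r0; rewrite -[r in LHS](ger0_norm r0) -sqrtr_sqr ler_sqrt//.
exact: sqr_ge0.
Qed.

(** * Quadratic parts of functions and of polynomials *)

Definition linear_part {R : realType} {n : nat} (l F : 'rV[R]_n -> R) : Prop :=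
  (forall (t : R) h, l (t *: h) = t * l h) /\
  (forall x h, F (x + h) = F x + l h).

(** Half the Hessian form of a polynomial of degree at most 2, characterised by
    central second differences that do not depend on the base point.  Compared
    with a coefficient matrix, this form passes directly through sums, scalar
    multiples and products of affine functions, and it is what midpoint
    convexity speaks of. *)
Definition quadratic_part {R : realType} {n : nat} (q F : 'rV[R]_n -> R) :
    Prop :=
  (forall (t : R) h, q (t *: h) = t ^+ 2 * q h) /\
  (forall x h, F (x + h) + F (x - h) = 2 * F x + 2 * q h).

(** Monomials of degree at most 2 are such products, so this is where the
    quadratic part of a polynomial comes from. *)
Lemma quadratic_part_mul (R : realType) (n : nat)
    (l1 F1 l2 F2 : 'rV[R]_n -> R) :
  linear_part l1 F1 -> linear_part l2 F2 ->
  quadratic_part (fun h => l1 h * l2 h) (fun x => F1 x * F2 x).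
Proof.
move=> [l1Z F1D] [l2Z F2D]; split=> [t h|x h]; first by rewrite l1Z l2Z; ring.
by rewrite -[- h]scaleN1r !F1D !F2D l1Z l2Z; ring.
Qed.

Lemma quadratic_partZ (R : realType) (n : nat) (c : R) (q F : 'rV[R]_n -> R) :
  quadratic_part q F -> quadratic_part (fun h => c * q h) (fun x => c * F x).
Proof.
move=> [qZ FD]; split=> [t h|x h]; first by rewrite qZ; ring.
by rewrite -mulrDr FD; ring.
Qed.

Lemma quadratic_partD (R : realType) (n : nat) (q1 F1 q2 F2 : 'rV[R]_n -> R) :
  quadratic_part q1 F1 -> quadratic_part q2 F2 ->
  quadratic_part (fun h => q1 h + q2 h) (fun x => F1 x + F2 x).
Proof.
move=> [q1Z F1D] [q2Z F2D]; split=> [t h|x h]; first by rewrite q1Z q2Z; ring.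
by rewrite addrACA F1D F2D; ring.
Qed.

Lemma quadratic_part_cst (R : realType) (n : nat) (c : R) :
  @quadratic_part R n (fun=> 0) (fun=> c).
Proof. by split=> [t h|x h]; ring. Qed.

Lemma quadratic_part_sum (R : realType) (n : nat) (I : eqType) (r : seq I)
    (F : I -> 'rV[R]_n -> R) :
  (forall i, i \in r -> exists q, quadratic_part q (F i)) ->
  exists q, quadratic_part q (fun x => \sum_(i <- r) F i x).
Proof.
elim: r => [|i r IH] qF.
  exists (fun=> 0); rewrite (_ : (fun x => \sum_(i <- [::]) F i x) = fun=> 0).
    exact: quadratic_part_cst.
  by apply/funext => x; rewrite big_nil.
have [q1 q1F] := qF i (mem_head i r).
have [|q2 q2F] := IH; first by move=> j jr; apply: qF; rewrite inE jr orbT.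
exists (fun h => q1 h + q2 h).
rewrite (_ : (fun x => \sum_(j <- i :: r) F j x) =
            fun x => F i x + \sum_(j <- r) F j x).
  exact: (quadratic_partD q1F q2F).
by apply/funext => x; rewrite big_cons.
Qed.

Lemma linear_part_monomial (R : realType) (n : nat) (m : multinom n) :
  (mdeg m <= 1)%N -> exists l, linear_part l (poly_fun (mpolyX R m)).
Proof.
rewrite leq_eqVlt ltnS leqn0 mdeg_eq0 => /orP[/mdeg1P[i]|] /eqP ->.
  exists (fun h => h 0 i); split=> [t h|x h]; first by rewrite mxE.
  by rewrite /poly_fun !mevalXU mxE.
exists (fun=> 0); split=> [t h|x h]; first by rewrite mulr0.
by rewrite /poly_fun mpolyX0 !meval1 addr0.
Qed.

(** This makes a monomial of degree at most 2 a product of two affine ones. *)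
Lemma mnm_split_deg2 (n : nat) (m : multinom n) : (mdeg m <= 2)%N ->
  exists m1 m2 : multinom n,
    [/\ m = mnm_add m1 m2, (mdeg m1 <= 1)%N & (mdeg m2 <= 1)%N].
Proof.
move=> m2; have [m0|/existsPn mi] := boolP [exists i, 0 < m i]%N; last first.
  exists mnm0, mnm0; rewrite addm0 !mdeg0; split=> //; apply/mnmP => i.
  by rewrite mnm0E; apply/eqP; rewrite -leqn0 leqNgt mi.
have /existsP[i mi] := m0; exists (mnm1 i), (mnm_sub m (mnm1 i)).
have Um : mnm_add (mnm1 i) (mnm_sub m (mnm1 i)) = m.
  rewrite [LHS]addmC submK//; apply/mnm_lepP => j; rewrite mnm1E.
  by case: eqVneq => [<-|].
split; rewrite ?mdeg1//.
by move: m2; rewrite -{1}Um mdegD mdeg1 ltnS.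
Qed.

Lemma quadratic_part_monomial (R : realType) (n : nat) (m : multinom n) :
  (mdeg m <= 2)%N -> exists q, quadratic_part q (poly_fun (mpolyX R m)).
Proof.
move=> /mnm_split_deg2[m1 [m2 [-> m11 m21]]].
have [l1 l1P] := linear_part_monomial R m11.
have [l2 l2P] := linear_part_monomial R m21.
exists (fun h => l1 h * l2 h).
have -> : poly_fun (mpolyX R (mnm_add m1 m2)) =
    fun x => poly_fun (mpolyX R m1) x * poly_fun (mpolyX R m2) x.
  by apply/funext => x; rewrite /poly_fun mpolyXD mevalM.
exact: quadratic_part_mul l1P l2P.
Qed.

Lemma quadratic_part_poly (R : realType) (n : nat) (P : mpoly n R) :
  polys 2 P -> exists q, quadratic_part q (poly_fun P).
Proof.
move=> P2.
have -> : poly_fun P =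
    fun x => \sum_(m <- msupp P) mcoeff m P * poly_fun (mpolyX R m) x.
  apply/funext => x; rewrite /poly_fun mevalE.
  by apply: eq_bigr => m _; rewrite mevalX.
apply: quadratic_part_sum => m mP.
have [|q qm] := @quadratic_part_monomial R _ m.
  by rewrite -ltnS; apply: leq_trans P2; apply: mmeasure_mnm_lt.
by exists (fun h => mcoeff m P * q h); exact: quadratic_partZ.
Qed.

(** Apply the second difference identity at the midpoint of x and y, with
    step (x - y) / 2. *)
Lemma quadratic_part_midconvex (R : realType) (n : nat)
    (q F : 'rV[R]_n -> R) : quadratic_part q F -> (forall h, 0 <= q h) ->
  forall x y, F x + F y >= 2 * F (2^-1 *: (x + y)).
Proof.
move=> [_ FD] q0 x y.
have /(_ (2^-1 *: (x - y))) := FD (2^-1 *: (x + y)).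
rewrite -scalerDr -scalerBr.
have -> : (x + y) + (x - y) = 2 *: x by rewrite addrACA subrr addr0 scaler_nat.
have -> : (x + y) - (x - y) = 2 *: y.
  by rewrite opprB addrC addrA subrK scaler_nat mulr2n.
rewrite !scalerA mulVf ?scale1r ?pnatr_eq0// => ->.
by rewrite lerDl mulr_ge0.
Qed.

(** * Continuity of polynomial functions *)

Lemma sum_continuous (R : realType) (T : topologicalType) (I : Type) (r : seq I)
    (F : I -> T -> R) : (forall i, continuous (F i)) ->
  continuous (fun x => \sum_(i <- r) F i x).
Proof.
move=> cF x; elim: r => [|i r IH].
  rewrite (_ : (fun _ => _) = fun=> 0); first exact: cst_continuous.
  by apply/funext => y; rewrite big_nil.
rewrite (_ : (fun _ => _) = fun y => F i y + \sum_(j <- r) F j y).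
  exact: continuousD (cF i x) IH.
by apply/funext => y; rewrite big_cons.
Qed.

Lemma prod_continuous (R : realType) (T : topologicalType) (I : Type)
    (r : seq I) (F : I -> T -> R) : (forall i, continuous (F i)) ->
  continuous (fun x => \prod_(i <- r) F i x).
Proof.
move=> cF x; elim: r => [|i r IH].
  rewrite (_ : (fun _ => _) = fun=> 1); first exact: cst_continuous.
  by apply/funext => y; rewrite big_nil.
rewrite (_ : (fun _ => _) = fun y => F i y * \prod_(j <- r) F j y).
  exact: continuousM (cF i x) IH.
by apply/funext => y; rewrite big_cons.
Qed.

Lemma poly_fun_continuous (R : realType) (n : nat) (P : mpoly n R) :
  continuous (poly_fun P).
Proof.
rewrite (_ : poly_fun P = fun x : 'rV[R]_n =>
  \sum_(m <- msupp P) mcoeff m P * \prod_(i <- index_enum 'I_n) x 0 i ^+ m i).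
  apply: sum_continuous => m x; apply: continuousM; first exact: cst_continuous.
  apply: prod_continuous => i y.
  apply: (@continuous_comp _ _ _ (fun x : 'rV[R]_n => x 0 i)
    (fun t : R => t ^+ m i)); first exact: coord_continuous.
  exact: exprn_continuous.
by apply/funext => x; rewrite /poly_fun mevalE.
Qed.

(** * The polynomial |(x - c) A|^2 *)

Definition affine_coord {R : realType} {n : nat} (A : 'M[R]_n) (c : 'rV[R]_n)
    (j : 'I_n) : mpoly n R :=
  \sum_i A i j *: (mpolyX R (mnm1 i) - mpolyC n (c 0 i)).

Lemma poly_fun_affine_coord (R : realType) (n : nat) (A : 'M[R]_n)
    (c x : 'rV[R]_n) (j : 'I_n) :
  poly_fun (affine_coord A c j) x = ((x - c) *m A) 0 j.
Proof.
rewrite /poly_fun /affine_coord raddf_sum /= mxE; apply: eq_bigr => i _.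
by rewrite mevalZ mevalB mevalXU mevalC !mxE mulrC.
Qed.

Definition square_poly {R : realType} {n : nat} (A : 'M[R]_n) (c : 'rV[R]_n) :
    mpoly n R :=
  \sum_j affine_coord A c j * affine_coord A c j.

Lemma poly_fun_square (R : realType) (n : nat) (A : 'M[R]_n) (c x : 'rV[R]_n) :
  poly_fun (square_poly A c) x = sqnorm ((x - c) *m A).
Proof.
rewrite /poly_fun /square_poly raddf_sum /=; apply: eq_bigr => j _.
by rewrite mevalM -/(poly_fun _ x) poly_fun_affine_coord.
Qed.

Lemma polysD (R : realType) (n m : nat) (P Q : mpoly n R) :
  polys m P -> polys m Q -> polys m (P + Q).
Proof.
move=> mP mQ; apply: leq_trans (msizeD_le _ _) _.
by rewrite geq_max; apply/andP.
Qed.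

Lemma polysZ (R : realType) (n m : nat) (c : R) (P : mpoly n R) :
  polys m P -> polys m (c *: P).
Proof. by move=> mP; apply: leq_trans (msizeZ_le _ _) mP. Qed.

Lemma polysC (R : realType) (n m : nat) (c : R) : polys m (mpolyC n c).
Proof. by rewrite /polys /= mmeasureC; case: (c != 0). Qed.

Lemma polys_sum (R : realType) (n m : nat) (I : Type) (r : seq I)
    (F : I -> mpoly n R) :
  (forall i, polys m (F i)) -> polys m (\sum_(i <- r) F i).
Proof.
move=> mF; elim/big_ind : _ => [|P Q|i _]; [|exact: polysD|exact: mF].
by rewrite /polys /= mmeasure0.
Qed.

Lemma polys_square (R : realType) (n : nat) (A : 'M[R]_n) (c : 'rV[R]_n) :
  polys 2 (square_poly A c).
Proof.
have affine1 j : polys 1 (affine_coord A c j).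
  apply: polys_sum => i; apply/polysZ/polysD.
    by rewrite /polys /= msizeX mdeg1.
  by rewrite -mpolyCN; exact: polysC.
apply: polys_sum => j; rewrite /polys /=.
have [->|nz] := eqVneq (affine_coord A c j) 0; first by rewrite mul0r mmeasure0.
rewrite msizeM// -subn1 leq_subLR; exact: leq_add (affine1 j) (affine1 j).
Qed.

Lemma quadratic_part_square (R : realType) (n : nat) (A : 'M[R]_n)
    (c : 'rV[R]_n) :
  quadratic_part (fun h => sqnorm (h *m A)) (poly_fun (square_poly A c)).
Proof.
split=> [t h|x h]; first by rewrite -scalemxAl sqnormZ.
rewrite !poly_fun_square /sqnorm !mulr_sumr -!big_split /=.
apply: eq_bigr => j _.
rewrite addrAC (addrAC x (- h)) mulmxDl (mulmxBl _ h) !mxE; ring.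
Qed.

(** * The uniform norm on a compact set *)

Lemma cont_on_subpoly (R : realType) (n : nat) (K : set 'rV[R]_n)
    (f : 'rV[R]_n -> R) (P : mpoly n R) :
  cont_on K f -> cont_on K (f \- poly_fun P).
Proof.
move=> cf x; apply: continuousB; first exact: cf.
exact: (continuous_subspaceT (@poly_fun_continuous R n P)).
Qed.

Lemma le_norm_on (R : realType) (n : nat) (K : set 'rV[R]_n)
    (g : 'rV[R]_n -> R) (x : 'rV[R]_n) :
  compact K -> cont_on K g -> K x -> `|g x| <= norm_on K g.
Proof.
move=> cK cg Kx; apply: ub_le_sup; last by exists x.
have /compact_bounded[M [_ Mg]] := continuous_compact cg cK.
exists (M + 1) => _ [y Ky <-]; apply: Mg; first by rewrite ltrDl.
by exists y.
Qed.

Lemma norm_on_le (R : realType) (n : nat) (K : set 'rV[R]_n)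
    (g : 'rV[R]_n -> R) (M : R) :
  K !=set0 -> (forall x, K x -> `|g x| <= M) -> norm_on K g <= M.
Proof.
move=> [x Kx] gM; apply: ge_sup; first by exists `|g x|, x.
by move=> _ [y Ky <-]; exact: gM.
Qed.

Lemma convex_body_nonempty (R : realType) (n : nat) (K : set 'rV[R]_n) :
  convex_body K -> K !=set0.
Proof. by case=> _ _ [x /interior_subset Kx]; exists x. Qed.

Lemma norm_on_ge0 (R : realType) (n : nat) (K : set 'rV[R]_n)
    (g : 'rV[R]_n -> R) : K !=set0 -> compact K -> cont_on K g ->
  0 <= norm_on K g.
Proof.
by move=> [x Kx] cK cg; apply: le_trans (le_norm_on cK cg Kx).
Qed.

(** * Convexifiers *)

(** Invertibility of A turns the inclusion of the ball in the image of K into: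
    c + h lies in K as soon as |h A^T| <= 1.  Rescaling h to |h A^T| = 1 and
    comparing f with P at c and at c +- h gives q(h) >= -2 e for that h; the
    general case is homogeneity, and h A^T = 0 only for h = 0. *)
Lemma curvature_lower_bound (R : realType) (n : nat) (K : set 'rV[R]_n)
    (f P q : 'rV[R]_n -> R) (A : 'M[R]_n) (b c : 'rV[R]_n) (e : R) :
  (forall x y, K x -> K y -> f x + f y >= 2 * f (2^-1 *: (x + y))) ->
  (forall x, K x -> `|f x - P x| <= e) -> quadratic_part q P ->
  \det A != 0 -> euclidean_ball (R:=R) (n:=n) `<=` affine_image A b K ->
  K c -> c *m A^T + b = 0 ->
  forall h, 0 <= q h + 2 * e * sqnorm (h *m A^T).
Proof.
move=> fconv fP [qZ PD] detA BAK Kc cA h.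
have Aunit : A^T \in unitmx by rewrite unitmx_tr unitmxE unitfE.
have inK v : sqnorm (v *m A^T) <= 1 -> K (c + v).
  move=> v1; have [|x Kx xv] := BAK (v *m A^T).
    by rewrite /euclidean_ball /= enorm_le// expr1n.
  suff -> : c + v = x by [].
  apply: (can_inj (mulmxK Aunit)); apply: (addIr b).
  by rewrite mulmxDl addrAC cA add0r.
have [h0|h0] := eqVneq (sqnorm (h *m A^T)) 0.
  have : h *m A^T = 0 by exact: sqnorm_eq0.
  move=> /(congr1 (mulmx^~ (invmx A^T))); rewrite mulmxK// mul0mx => hE.
  by have := qZ 0 0; rewrite scaler0 expr0n mul0r h0 mulr0 addr0 hE => ->.
have t0 : 0 < sqnorm (h *m A^T) by rewrite lt_neqAle eq_sym h0 sqnorm_ge0.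
set t := sqnorm _ in h0 t0 *.
pose s := (Num.sqrt t)^-1.
have s2 : s ^+ 2 = t^-1 by rewrite /s exprVn sqr_sqrtr// ltW.
have Kp : K (c + s *: h).
  by apply: inK; rewrite -scalemxAl sqnormZ s2 mulVf.
have Km : K (c - s *: h).
  by apply: inK; rewrite -scaleNr -scalemxAl sqnormZ sqrrN s2 mulVf.
have := fconv _ _ Kp Km; have := PD c (s *: h); rewrite qZ s2.
have -> : 2^-1 *: (c + s *: h + (c - s *: h)) = c.
  rewrite addrACA subrr addr0 -mulr2n -(scaler_nat 2 c) scalerA.
  by rewrite mulVf ?pnatr_eq0// scale1r.
move=> PE fE.
have := fP _ Kp; have := fP _ Km; have := fP _ Kc; rewrite !ler_norml.
move=> /andP[c1 c2] /andP[m1 m2] /andP[p1 p2].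
have : 0 <= t^-1 * q h + 2 * e by lra.
rewrite -(pmulr_rge0 _ t0) mulrDr mulrA mulfV// mul1r.
by rewrite [t * _]mulrC.
Qed.

(** For e >= 0, pairs (A, c) for which P + 2 e |(x - c) A|^2 is convex, q being
    the quadratic part of P, and the added term is at most 2 e lam^2 on K.  For
    compact K all the conditions are closed, so that they survive limits.  The matrix
    is flattened into a row vector, so that a bound on its entries describes a
    compact box of row vectors. *)
Definition convexifiers {R : realType} {n : nat} (K : set 'rV[R]_n)
    (q : 'rV[R]_n -> R) (e lam : R) : set ('rV[R]_(n * n) * 'rV[R]_n) :=
  [set p | [/\ K p.2, forall h, 0 <= q h + 2 * e * sqnorm (h *m vec_mx p.1)
    & forall x, K x -> sqnorm ((x - p.2) *m vec_mx p.1) <= lam ^+ 2]].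

(** The affine maps that occur in the definition of the Banach-Mazur distance
    yield convexifiers; the centre c is the preimage in K of the centre of the
    ball. *)
Lemma convexifiers_bm (R : realType) (n : nat) (K : set 'rV[R]_n)
    (f P q : 'rV[R]_n -> R) (A : 'M[R]_n) (b : 'rV[R]_n) (e lam : R) :
  (forall x y, K x -> K y -> f x + f y >= 2 * f (2^-1 *: (x + y))) ->
  (forall x, K x -> `|f x - P x| <= e) -> quadratic_part q P ->
  0 < lam -> \det A != 0 ->
  euclidean_ball (R:=R) (n:=n) `<=` affine_image A b K ->
  affine_image A b K `<=` [set lam *: x | x in euclidean_ball (R:=R) (n:=n)] ->
  convexifiers K q e lam !=set0.
Proof.
move=> fconv fP qP lam0 detA BAK AKB.
have [|c Kc cA] := BAK 0.
  rewrite /euclidean_ball /= enorm_le// /sqnorm big1 ?expr1n// => i _.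
  by rewrite mxE expr0n.
exists (mxvec A^T, c); split=> //=; rewrite mxvecK.
  exact: curvature_lower_bound fconv fP qP detA BAK Kc cA.
move=> x Kx; have [|y y1 yE] := AKB (x *m A^T + b); first by exists x.
have -> : (x - c) *m A^T = x *m A^T + b.
  rewrite mulmxBl; congr (_ + _); apply/esym/eqP.
  by rewrite -addr_eq0 addrC cA.
rewrite -yE sqnormZ -[leRHS]mulr1 ler_wpM2l ?sqr_ge0//.
by move: y1; rewrite /euclidean_ball /= enorm_le// expr1n.
Qed.

(** * Passing to the limit in the radius *)

Lemma sqnorm_mul_continuous (R : realType) (n : nat) (T : topologicalType)
    (v : T -> 'rV[R]_n) (a : T -> 'rV[R]_(n * n)) :
  (forall i, continuous (fun p => v p 0 i)) ->
  (forall k, continuous (fun p => a p 0 k)) ->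
  continuous (fun p => sqnorm (v p *m vec_mx (a p))).
Proof.
move=> cv ca.
rewrite (_ : (fun p => sqnorm (v p *m vec_mx (a p))) = fun p =>
    \sum_(j <- index_enum 'I_n) (\sum_(i <- index_enum 'I_n)
      v p 0 i * a p 0 (mxvec_index i j)) ^+ 2); last first.
  apply/funext => p; apply: eq_bigr => j _; rewrite mxE.
  by congr (_ ^+ 2); apply: eq_bigr => i _; rewrite mxE.
apply: sum_continuous => j p.
apply: (@continuous_comp _ _ _ (fun p => \sum_(i <- index_enum 'I_n)
      v p 0 i * a p 0 (mxvec_index i j)) (fun t : R => t ^+ 2)).
  by apply: sum_continuous => i {}p; exact: continuousM (cv i p) (ca _ p).
exact: exprn_continuous.
Qed.

Lemma convexifiers_le (R : realType) (n : nat) (K : set 'rV[R]_n)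
    (q : 'rV[R]_n -> R) (e lam lam' : R) : 0 <= lam -> lam <= lam' ->
  convexifiers K q e lam `<=` convexifiers K q e lam'.
Proof.
move=> lam0 ll p [Kp qp Kl]; split=> // x Kx; apply: le_trans (Kl x Kx) _.
by rewrite ler_pXn2r// nnegrE// (le_trans lam0).
Qed.

Lemma convexifiers_closed (R : realType) (n : nat) (K : set 'rV[R]_n)
    (q : 'rV[R]_n -> R) (e lam : R) :
  compact K -> closed (convexifiers K q e lam).
Proof.
move=> cK; pose T := ('rV[R]_(n * n) * 'rV[R]_n)%type.
rewrite (_ : convexifiers K q e lam = (snd @^-1` K) `&`
    \bigcap_(h in setT) ((fun p : T => q h + 2 * e * sqnorm (h *m vec_mx p.1))
      @^-1` [set t | 0 <= t]) `&`
    \bigcap_(x in K) ((fun p : T => sqnorm ((x - p.2) *m vec_mx p.1))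
      @^-1` [set t | t <= lam ^+ 2])); last first.
  apply/seteqP; split=> p [].
    by move=> Kp qp xp; split; [split=> // h _; exact: qp|exact: xp].
  by move=> [Kp qp] xp; split=> // h; exact: qp.
have coord1 k : continuous (fun p : T => p.1 0 k).
  move=> p.
  apply: (@continuous_comp _ _ _ fst (fun a : 'rV[R]_(n * n) => a 0 k)).
    exact: cvg_fst.
  exact: coord_continuous.
have coord2 k : continuous (fun p : T => p.2 0 k).
  move=> p; apply: (@continuous_comp _ _ _ snd (fun a : 'rV[R]_n => a 0 k)).
    exact: cvg_snd.
  exact: coord_continuous.
apply: closedI; first apply: closedI.
- apply: preimage_closed => [p _|]; first exact: cvg_snd.
  by apply: compact_closed => //; exact: norm_hausdorff.
- apply: closed_bigI => h _; apply: preimage_closed => [p _|]; last first.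
    exact: closed_ge.
  apply: (@continuousD _ _ _ (fun=> q h)
    (fun p : T => 2 * e * sqnorm (h *m vec_mx p.1))).
    exact: cst_continuous.
  apply: (@continuousM _ _ (fun=> 2 * e)
    (fun p : T => sqnorm (h *m vec_mx p.1))).
    exact: cst_continuous.
  by apply: sqnorm_mul_continuous => // i; exact: cst_continuous.
- apply: closed_bigI => x _; apply: preimage_closed => [p _|]; last first.
    exact: closed_le.
  apply: sqnorm_mul_continuous => // i {}p.
  rewrite (_ : (fun p : T => (x - p.2) 0 i) = fun p => x 0 i - p.2 0 i).
    by apply: continuousB; [exact: cst_continuous|exact: coord2].
  by apply/funext => u; rewrite !mxE.
Qed.

(** The norm of row vectors is the sup norm, so its balls are boxes. *)
Lemma interior_box (R : realType) (n : nat) (K : set 'rV[R]_n) :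
  K° !=set0 -> exists (x0 : 'rV[R]_n) (rho : R), 0 < rho /\
    forall v : 'rV[R]_n, (forall i, `|v 0 i| <= rho) -> K (x0 + v).
Proof.
move=> [x0 /nbhs_ballP[r /= r0 rK]]; exists x0, (r / 2).
split=> [|v vr]; first by rewrite divr_gt0.
apply: rK; rewrite mx_norm_ball /ball_ /= opprD addrA subrr add0r normrN.
apply: (@le_lt_trans _ _ (r / 2)); last first.
  by rewrite ltr_pdivrMr// ltr_pMr// ltr1n.
rewrite [leLHS]/Num.norm /= mx_normrE; apply: bigmax_le.
  by rewrite divr_ge0// ltW.
by move=> [i j] _ /=; rewrite ord1; exact: vr.
Qed.

(** Row i of the matrix, scaled by rho, is the difference of the images of two
    points x0 and x0 + rho e_i of K, both of norm at most lam. *)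
Lemma convexifiers_bounded (R : realType) (n : nat) (K : set 'rV[R]_n)
    (q : 'rV[R]_n -> R) (e lam : R) : K° !=set0 -> 0 <= lam ->
  exists M, forall lam' p k, 0 <= lam' <= lam -> convexifiers K q e lam' p ->
    `|p.1 0 k| <= M.
Proof.
move=> /interior_box[x0 [rho [rho0 boxK]]] lam0; exists (2 * lam / rho).
move=> lam' [a c] k /andP[l0 ll] [/= _ _ Kl].
case/mxvec_indexP: k => i j.
have Kx0 : K x0 by rewrite -[x0]addr0; apply: boxK => k; rewrite mxE normr0 ltW.
have Kx1 : K (x0 + rho *: delta_mx 0 i).
  apply: boxK => k; rewrite !mxE eqxx /= normrM gtr0_norm//.
  by rewrite ger_pMr// normr_nat; case: (k == i); rewrite ?lexx ?ler01.
have coordl x : K x -> `|((x - c) *m vec_mx a) 0 j| <= lam.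
  move=> Kx; apply: le_trans ll; rewrite -(@ler_pXn2r _ 2)// ?nnegrE//.
  rewrite real_normK ?num_real//; apply: le_trans (Kl _ Kx).
  exact: coord_sqr_le_sqnorm.
rewrite ler_pdivlMr// mulrC -{1}(gtr0_norm rho0) -normrM.
have -> : rho * a 0 (mxvec_index i j) =
    ((x0 + rho *: delta_mx 0 i - c) *m vec_mx a) 0 j -
    ((x0 - c) *m vec_mx a) 0 j.
  rewrite addrAC (mulmxDl (x0 - c)) -scalemxAl -rowE.
  by rewrite [in RHS]mxE addrAC subrr add0r !mxE.
apply: le_trans (ler_normB _ _) _.
by rewrite mulr_natl mulr2n lerD// coordl.
Qed.

(** Choose a convexifier for each lam > d.  As lam decreases to d they stay in
    the product of a box and K, so they have a cluster point.  For each
    lam > d it lies in the closed set of convexifiers for lam, and letting lam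
    tend to d in the bound on K concludes. *)
Lemma convexifiers_limit (R : realType) (n : nat) (K : set 'rV[R]_n)
    (q : 'rV[R]_n -> R) (e d : R) : compact K -> K° !=set0 -> 0 <= d ->
  (forall lam, d < lam -> convexifiers K q e lam !=set0) ->
  convexifiers K q e d !=set0.
Proof.
move=> cK intK d0 ex.
have [M Mb] := @convexifiers_bounded _ _ _ q e (d + 1) intK (addr_ge0 d0 ler01).
pose T := ('rV[R]_(n * n) * 'rV[R]_n)%type.
have /choice[g gP] :
    forall lam, exists p : T, d < lam -> convexifiers K q e lam p.
  move=> lam; have [/ex[p pP]|_] := ltP d lam; first by exists p.
  by exists 0.
pose C : set T :=
  [set a : 'rV[R]_(n * n) | forall k, `[- M, M]%classic (a 0 k)] `*` K.
have cC : compact C.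
  apply: compact_setX => //.
  apply: (@rV_compact _ _ (fun=> `[- M, M]%classic)) => _.
  exact: segment_compact.
have near_conv lam : d < lam ->
    \forall l \near d^'+, convexifiers K q e lam (g l).
  move=> dlam; near=> l.
  have dl : d < l by near: l; exact: nbhs_right_gt.
  apply: (convexifiers_le (ltW (le_lt_trans d0 dl))) (gP _ dl).
  by near: l; exact: nbhs_right_le.
have nearC : \forall l \near d^'+, C (g l).
  have d1 : d < d + 1 by rewrite ltrDl.
  near=> l.
  have gl : convexifiers K q e (d + 1) (g l) by near: l; exact: near_conv.
  split; last by case: gl.
  move=> k /=; rewrite in_itv /= -ler_norml; apply: Mb gl.
  by rewrite lexx andbT addr_ge0.
have [p [Cp clp]] := cC (g @ d^'+) _ nearC.
have pP lam : d < lam -> convexifiers K q e lam p.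
  move=> dlam; apply: (convexifiers_closed cK) => B pB.
  exact: clp (near_conv _ dlam) pB.
exists p; have [Kp qp _] : convexifiers K q e (d + 1) p.
  by apply: pP; rewrite ltrDl.
split=> // x Kx; rewrite -enorm_le//; apply/ler_addgt0Pr => eps eps0.
rewrite enorm_le; last by rewrite addr_ge0// ltW.
by have [|_ _] := pP (d + eps); [rewrite ltrDl|exact].
Unshelve. all: by end_near. Qed.

(** * The Banach-Mazur distance to the ball *)

(** The infimum of the empty set would be 0 by convention, so that d(K) means
    something only because of this lemma.  A box of half-side rho around x0
    inside K contains the Euclidean ball of radius rho, and scaling by 1 / rho
    about x0 sends that ball onto the unit ball; and K is bounded. *)
Lemma bm_dist_admissible_nonempty (R : realType) (n : nat) (K : set 'rV[R]_n) :
  convex_body K ->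
  [set lambda : R | 0 < lambda /\
    exists (A : 'M[R]_n) b,
      [/\ \det A != 0,
          euclidean_ball (R:=R) (n:=n) `<=` affine_image A b K
        & affine_image A b K `<=`
            [set lambda *: x | x in euclidean_ball (R:=R) (n:=n)]]]
  !=set0.
Proof.
move=> bodyK; have [cK _ /interior_box[x0 [rho [rho0 boxK]]]] := bodyK.
pose A : 'M[R]_n := rho^-1%:M; pose b := - (x0 *m A).
pose g : 'rV[R]_n -> R := poly_fun (square_poly A x0).
have cg : cont_on K g by apply/continuous_subspaceT/poly_fun_continuous.
have M0 : 0 <= norm_on K g.
  by apply: norm_on_ge0 => //; exact: convex_body_nonempty.
have lam0 : 0 < 1 + norm_on K g by rewrite ltr_pwDl.
exists (1 + norm_on K g); split=> //; exists A, b; split.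
- by rewrite det_scalar expf_neq0// invr_eq0 gt_eqF.
- move=> u u1; exists (x0 + rho *: u); last first.
    rewrite tr_scalar_mx mulmxDl addrAC subrr add0r mul_mx_scalar scalerA.
    by rewrite mulVf ?gt_eqF// scale1r.
  apply: boxK => i; rewrite mxE normrM gtr0_norm// ger_pMr//.
  rewrite -(@ler_pXn2r _ 2)// ?nnegrE// real_normK ?num_real//.
  apply: le_trans (coord_sqr_le_sqnorm u i) _.
  by move: u1; rewrite /euclidean_ball /= enorm_le.
- move=> _ [x Kx <-]; rewrite tr_scalar_mx -mulmxBl.
  exists ((1 + norm_on K g)^-1 *: ((x - x0) *m A)); last first.
    by rewrite scalerA mulfV ?gt_eqF// scale1r.
  (* With M the supremum of |(x - x0) A|^2 on K, the radius 1 + M is enough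
     since M <= (1 + M)^2. *)
  rewrite /euclidean_ball /= enorm_le// expr1n sqnormZ exprVn mulrC.
  rewrite ler_pdivrMr ?exprn_gt0// mul1r -poly_fun_square -/g.
  apply: le_trans (ler_norm _) _; apply: le_trans (le_norm_on cK cg Kx) _.
  by nra.
Qed.

(** A unit vector exists as n > 0, and it lies in the unit ball, hence in the
    ball of radius lambda. *)
Lemma bm_dist_ge1 (R : realType) (n : nat) (K : set 'rV[R]_n) :
  (0 < n)%N -> convex_body K -> 1 <= bm_dist K.
Proof.
move=> n0 bodyK; apply: lb_le_inf; first exact: bm_dist_admissible_nonempty.
move=> lam [lam0 [A [b [_ BAK AKB]]]].
pose i0 : 'I_n := Ordinal n0.
have e1 : sqnorm (delta_mx 0 i0 : 'rV[R]_n) = 1.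
  rewrite /sqnorm (bigD1 i0)//= big1 => [|i ii0].
    by rewrite mxE !eqxx expr1n addr0.
  by rewrite mxE (negPf ii0) andbF expr0n.
have [|x x1 xE] := AKB (delta_mx 0 i0).
  by apply: BAK; rewrite /euclidean_ball /= enorm_le// expr1n e1.
rewrite -(@ler_pXn2r _ 2)// ?nnegrE ?(ltW lam0)// expr1n -e1 -xE sqnormZ.
rewrite ler_piMr ?sqr_ge0//.
by move: x1; rewrite /euclidean_ball /= enorm_le// expr1n.
Qed.

Lemma convexifiers_bm_dist (R : realType) (n : nat) (K : set 'rV[R]_n)
    (f P q : 'rV[R]_n -> R) (e : R) : (0 < n)%N -> convex_body K ->
  (forall x y, K x -> K y -> f x + f y >= 2 * f (2^-1 *: (x + y))) ->
  (forall x, K x -> `|f x - P x| <= e) -> quadratic_part q P ->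
  convexifiers K q e (bm_dist K) !=set0.
Proof.
move=> n0 bodyK fconv fP qP; have [cK _ intK] := bodyK.
have d1 := bm_dist_ge1 n0 bodyK.
apply: convexifiers_limit => //; first exact: le_trans d1.
move=> lam dlam.
have [|mu [mu0 [A [b [detA BAK AKB]]]] mulam] := inf_lt _ dlam.
  exact: bm_dist_admissible_nonempty.
have [p pP] := convexifiers_bm fconv fP qP mu0 detA BAK AKB.
by exists p; apply: convexifiers_le pP; exact: ltW.
Qed.

(** * Convex quadratic approximation *)

Lemma convex_quadratic_approx (R : realType) (n : nat) (K : set 'rV[R]_n)
    (f : 'rV[R]_n -> R) (P : mpoly n R) : (0 < n)%N ->
  convex_body K -> cont_convex_on K f -> polys 2 P ->
  exists2 Q : mpoly n R, convex_polys 2 K Q &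
    norm_on K (f \- poly_fun Q) <= approx_const K * norm_on K (f \- poly_fun P).
Proof.
move=> n0 bodyK [cf fconv] P2; have [cK _ _] := bodyK.
have K0 := convex_body_nonempty bodyK.
have cfP : cont_on K (f \- poly_fun P) by exact: cont_on_subpoly.
set e := norm_on K (f \- poly_fun P); set d := bm_dist K.
have e0 : 0 <= e by exact: norm_on_ge0.
have fP x : K x -> `|f x - poly_fun P x| <= e by exact: le_norm_on.
have d1 : 1 <= d by exact: bm_dist_ge1.
have [q qP] := quadratic_part_poly P2.
have [p [_ qp Kp]] := convexifiers_bm_dist n0 bodyK fconv fP qP.
(* On K the values of 2 e S lie in [0, 2 e d^2]; subtracting e d^2 centres
   them. *)
pose S := square_poly (vec_mx p.1) p.2.
pose Q := P + ((2 * e) *: S + mpolyC n (- (e * d ^+ 2))).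
have QE : poly_fun Q =
    fun x => poly_fun P x + (2 * e * poly_fun S x + - (e * d ^+ 2)).
  by apply/funext => x; rewrite /poly_fun !mevalD mevalZ mevalC.
have qQ := quadratic_partD qP (quadratic_partD
  (quadratic_partZ (2 * e) (quadratic_part_square (vec_mx p.1) p.2))
  (@quadratic_part_cst R n (- (e * d ^+ 2)))).
rewrite -/S -QE in qQ.
exists Q.
  split; first by apply/polysD/polysD/polysC => //; apply/polysZ/polys_square.
  split; first exact/continuous_subspaceT/poly_fun_continuous.
  move=> x y _ _; apply: (quadratic_part_midconvex qQ) => h.
  by rewrite addr0; exact: qp.
apply: norm_on_le => // x Kx; rewrite /= QE /approx_const -/d.
have /andP[fP1 fP2] : - e <= f x - poly_fun P x <= e.
  by rewrite -ler_norml; exact: fP.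
have s0 : 0 <= e * poly_fun S x.
  by rewrite mulr_ge0// poly_fun_square sqnorm_ge0.
have sd : e * poly_fun S x <= e * d ^+ 2.
  by rewrite ler_wpM2l// poly_fun_square; exact: Kp.
have ed : e <= e * d ^+ 2 by rewrite ler_peMr// exprn_ege1.
by rewrite ler_norml; apply/andP; split; lra.
Qed.

Lemma convex_best_approx_le (R : realType) (n : nat) (K : set 'rV[R]_n)
    (f : 'rV[R]_n -> R) : (0 < n)%N -> convex_body K -> cont_convex_on K f ->
  convex_best_approx 2 f K <= approx_const K * best_approx 2 f K.
Proof.
move=> n0 bodyK fconv; have [cf _] := fconv; have [cK _ _] := bodyK.
have a0 : 0 < approx_const K.
  by rewrite mulr_gt0// exprn_gt0// (lt_le_trans ltr01)// bm_dist_ge1.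
rewrite mulrC -ler_pdivrMr//; apply: lb_le_inf.
  exists (norm_on K (f \- poly_fun (mpolyC n 0))), (mpolyC n 0) => //.
  exact: polysC.
move=> _ [P P2 <-]; rewrite ler_pdivrMr// mulrC.
have [Q Qconv QP] := convex_quadratic_approx n0 bodyK fconv P2.
apply: le_trans QP; apply: ge_inf; last by exists Q.
exists 0 => _ [Q' _ <-]; apply: norm_on_ge0 => //.
  exact: convex_body_nonempty.
exact: cont_on_subpoly.
Qed.

Unset Implicit Arguments.
Set Strict Implicit.

Theorem theorem1p6 (R : realType) (n : nat) (hn : (0 < n)%N) :
  (forall (K : set 'rV[R]_n) (f : 'rV[R]_n -> R) (P : mpoly n R),
     convex_body K -> cont_convex_on K f -> polys 2 P ->
     exists2 Q : mpoly n R, convex_polys 2 K Q &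
       norm_on K (f \- poly_fun Q) <=
         approx_const K * norm_on K (f \- poly_fun P)) /\
  (forall (K : set 'rV[R]_n) (f : 'rV[R]_n -> R),
     convex_body K -> cont_convex_on K f ->
     convex_best_approx 2 f K <= approx_const K * best_approx 2 f K) /\
  (forall K : set 'rV[R]_n,
     convex_body K ->
     (whitney_convexity_preserving 3 K <=
        (approx_const K)%:E * whitney_convex 3 K)%E).
Proof.
split=> [K f P bodyK fconv|]; first exact: convex_quadratic_approx.
split=> [K f|K bodyK]; first exact: convex_best_approx_le.
have a0 : 0 <= approx_const K by rewrite mulr_ge0// sqr_ge0.
apply: ge_ereal_sup => _ [f [fconv fw] <-].
apply: (@le_trans _ _ ((approx_const K)%:E * (best_approx 2 f K)%:E)%E).
  by rewrite -EFinM lee_fin; exact: convex_best_approx_le.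
apply: lee_wpmul2l; first by rewrite lee_fin.
by apply: ereal_sup_ubound; exists f.
Qed.
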